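(* Let $\theta>0$, $h>0$ and $\mu=\frac12(\delta_{-1}+\delta_{+1})$. For $r\ge0$ and $\Psi\in[0,2\pi)$ let \[ q_{r,\Psi}(x,\eta)=[Z_{r,\Psi}(\eta)]^{-1}\exp\{2\theta r\cos(\Psi-x)+2h\eta\cos x\},\qquad Z_{r,\Psi}(\eta)=\int_0^{2\pi}\exp\{2\theta r\cos(\Psi-x)+2h\eta\cos x\}\,dx, \] and call a pair $(r,\Psi)$ with $r>0$ a ferromagnetic solution if it satisfies the self-consistency relation \[ r e^{i\Psi}=\int_{\{-1,+1\}}\int_0^{2\pi}e^{ix}\,q_{r,\Psi}(x,\eta)\,dx\,\mu(d\eta). \] Let $q^{(0)}(x,+1)=\exp\{2h\cos x\}\big/\int_0^{2\pi}\exp\{2h\cos y\}\,dy$ and set \[ \theta_1(h):=\frac12\left[\int_0^{2\pi}\sin^2(x)\,q^{(0)}(x,+1)\,dx\right]^{-1}, \] \[ \theta_2(h):=\frac12\left[\int_0^{2\pi}\cos^2(x)\,q^{(0)}(x,+1)\,dx-\left(\int_0^{2\pi}\cos(x)\,q^{(0)}(x,+1)\,dx\right)^2\right]^{-1}. \] Let $\bar h$ be the value of $h$ such that \[ \frac{d^3}{dr^3}\left[\frac{I_1(2(h+\theta r))}{I_0(2(h+\theta r))}-\frac{I_1(2(h-\theta r))}{I_0(2(h-\theta r))}\right]\Bigg|_{r=0}=0, \] where $I_v$ denotes the modified Bessel function of the first kind of order $v$. Then: (i) if $\theta\le\theta_1(h)$, there is no ferromagnetic solution; (ii) if $h\le\bar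 h$ and $\theta_1(h)<\theta\le\theta_2(h)$, there exist ferromagnetic solutions $(r_+,\frac{\pi}{2})$ and $(r_+,\frac{3\pi}{2})$; (iii) if $h>\bar h$ and $\theta_1(h)<\theta<\theta_2(h)$, there exists a further value $\theta_\star(h)$ with $\theta_1(h)<\theta_\star(h)<\theta_2(h)$ such that: if $\theta_1(h)<\theta\le\theta_\star(h)$, there exist ferromagnetic solutions $(r_+,\frac{\pi}{2})$ and $(r_+,\frac{3\pi}{2})$; if $\theta_\star(h)<\theta\le\theta_2(h)$, in addition to $(r_+,\frac{\pi}{2})$ and $(r_+,\frac{3\pi}{2})$, two further pairs of ferromagnetic solutions arise: $(\bar r_+,0)$, $(\bar r_+,\pi)$ and $(\hat r_+,0)$, $(\hat r_+,\pi)$, with $\bar r_+\neq\hat r_+$; (iv) if $\theta>\theta_2(h)$, there exist ferromagnetic solutions $(r_+,\frac{\pi}{2})$, $(r_+,\frac{3\pi}{2})$ and $(\bar r_+,0)$, $(\bar r_+,\pi)$. Here the values $r_+,\bar r_+,\hat r_+>0$ depend on the parameters $\theta$ and $h$.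
   Context: $\theta>0$ is the coupling strength, $h>0$ the field intensity, and $\mu$ the uniform law on $\{-1,+1\}$ of the random field. Ferromagnetic solutions correspond one-to-one to stationary solutions $q_{r,\Psi}$ with $r>0$ of the McKean–Vlasov limit of a mean-field XY model in the dichotomic random field. $I_v(y)=\frac{1}{2\pi}\int_0^{2\pi}\cos(v\alpha)e^{y\cos\alpha}\,d\alpha$. *)

(* Defs.v *)
From Stdlib Require Import Reals Lra.
From Coquelicot Require Import Coquelicot.
Open Scope R_scope.

(* Modified Bessel function of the first kind, integral representation:
   I_v(y) = (1/2pi) int_0^{2pi} cos(v a) e^{y cos a} da *)
Definition besselI (v y : R) : R :=
  / (2 * PI) * RInt (fun a => cos (v * a) * exp (y * cos a)) 0 (2 * PI).

Definition wgt (theta h r Psi x eta : R) : R :=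
  exp (2 * theta * r * cos (Psi - x) + 2 * h * eta * cos x).

Definition Zpart (theta h r Psi eta : R) : R :=
  RInt (fun x => wgt theta h r Psi x eta) 0 (2 * PI).

Definition q (theta h r Psi x eta : R) : R :=
  wgt theta h r Psi x eta / Zpart theta h r Psi eta.

Definition mu_int (f : R -> R) : R := / 2 * (f 1 + f (-1)).

(* Ferromagnetic solution: r > 0, Psi in [0, 2pi), and
   r e^{i Psi} = int_mu int_0^{2pi} e^{ix} q(x,eta) dx mu(deta),
   written as real and imaginary parts. *)
Definition ferro (theta h r Psi : R) : Prop :=
  0 < r /\ 0 <= Psi < 2 * PI /\
  r * cos Psi =
    mu_int (fun eta => RInt (fun x => cos x * q theta h r Psi x eta) 0 (2 * PI)) /\
  r * sin Psi =
    mu_int (fun eta => RInt (fun x => sin x * q theta h r Psi x eta) 0 (2 * PI)).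

Definition q0 (h x : R) : R :=
  exp (2 * h * cos x) / RInt (fun y => exp (2 * h * cos y)) 0 (2 * PI).

Definition theta1 (h : R) : R :=
  / 2 * / RInt (fun x => (sin x) ^ 2 * q0 h x) 0 (2 * PI).

Definition theta2 (h : R) : R :=
  / 2 * / (RInt (fun x => (cos x) ^ 2 * q0 h x) 0 (2 * PI)
           - (RInt (fun x => cos x * q0 h x) 0 (2 * PI)) ^ 2).

Definition D3 (theta h : R) : R :=
  Derive_n (fun r => besselI 1 (2 * (h + theta * r)) / besselI 0 (2 * (h + theta * r))
                   - besselI 1 (2 * (h - theta * r)) / besselI 0 (2 * (h - theta * r)))
           3 0.

(* Main.v *)
Require Import Defs.
From Stdlib Require Import Reals Lra.
From Coquelicot Require Import Coquelicot.
Open Scope R_scope.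

(** Let [A = I_1 / I_0] and [B y = A y / y]. Under the weight
    [exp (a cos x + b sin x)] the mean of [e^{ix}] is [B (|(a, b)|) (a, b)], so the
    self-consistency relation becomes a planar system. Either [sin Psi <> 0]; then
    injectivity of [B] forces [cos Psi = 0] and the system reduces to
    [2 theta B (2 sqrt ((theta r)^2 + h^2)) = 1], where [theta1 = 1 / (2 B (2 h))]. Or
    [sin Psi = 0], and the equation is
    [2 r = A (2 (h + theta r)) - A (2 (h - theta r))], whose slope at [r = 0] is governed by
    [theta2 = 1 / (2 A' (2 h))].

    On [y > 0] the Riccati equation [A' = 1 - A / y - A^2] with integrating factors yields
    [0 < A' < B] and [A'' < 0]; hence [B] decreases, [theta1 < theta2], and for
    [theta <= theta1] the aligned equation has no solution either. All existence
    claims follow from the intermediate value theorem and [|A| <= 1]. For [h > hbar],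
    [A'''] has no zero beyond [2 h]; it must be positive there, otherwise [A'] would become
    negative. So the aligned map lies above its tangent near [0], which gives two roots
    for [theta] slightly below [theta2]. *)

Ltac continuous_by_derive :=
  lazymatch goal with |- continuous _ _ => idtac | _ => intros ? end;
  apply (@ex_derive_continuous R_AbsRing R_NormedModule); auto_derive; trivial.

(** * Integrals over a period *)

Lemma ex_RInt_cont (f : R -> R) (a b : R) :
  (forall x, continuous f x) -> ex_RInt f a b.
Proof. intros Hf. apply (@ex_RInt_continuous R_CompleteNormedModule). intros; apply Hf. Qed.

Lemma RInt_lincomb (f g : R -> R) (u v a b : R) :
  (forall x, continuous f x) -> (forall x, continuous g x) ->
  RInt (fun x => u * f x + v * g x) a b = u * RInt f a b + v * RInt g a b.
Proof.
intros Hf Hg.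
apply is_RInt_unique.
apply (is_RInt_plus (V := R_NormedModule)); apply (is_RInt_scal (V := R_NormedModule));
  apply (RInt_correct (V := R_CompleteNormedModule)); now apply ex_RInt_cont.
Qed.

Lemma RInt_scal_l (f : R -> R) (u a b : R) :
  (forall x, continuous f x) ->
  RInt (fun x => u * f x) a b = u * RInt f a b.
Proof.
intros Hf.
apply is_RInt_unique, (is_RInt_scal (V := R_NormedModule)).
apply (RInt_correct (V := R_CompleteNormedModule)); now apply ex_RInt_cont.
Qed.

Lemma RInt_periodic_derive (f df : R -> R) :
  (forall x, is_derive f x (df x)) -> (forall x, continuous df x) ->
  f (2 * PI) = f 0 -> RInt df 0 (2 * PI) = 0.
Proof.
intros Hd Hc Hp.
apply is_RInt_unique.
replace 0 with (minus (f (2 * PI)) (f 0)) at 2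
  by (rewrite Hp; unfold minus, plus, opp; simpl; ring).
apply (is_RInt_derive (V := R_CompleteNormedModule)); intros; auto.
Qed.

Lemma RInt_shift (f : R -> R) (c a b : R) :
  (forall x, continuous f x) ->
  RInt (fun x => f (x + c)) a b = RInt f (a + c) (b + c).
Proof.
intros Hf.
generalize (RInt_comp_lin (V := R_CompleteNormedModule) f 1 c a b).
rewrite !Rmult_1_l. intros H. rewrite <- H by now apply ex_RInt_cont.
apply RInt_ext; intros x _. unfold scal; simpl; unfold mult; simpl.
now rewrite !Rmult_1_l.
Qed.

(** After the shift, the piece over [[2 PI, 2 PI + c]] is a translate of the missing piece over
    [[0, c]]. *)
Lemma RInt_periodic_shift (f : R -> R) (c : R) :
  (forall x, continuous f x) -> (forall x, f (x + 2 * PI) = f x) ->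
  RInt (fun x => f (x + c)) 0 (2 * PI) = RInt f 0 (2 * PI).
Proof.
intros Hf Hp.
rewrite RInt_shift by assumption. rewrite Rplus_0_l.
assert (Hch : forall u v w, RInt f u v + RInt f v w = RInt f u w).
{ intros u v w. apply (RInt_Chasles (V := R_CompleteNormedModule)); now apply ex_RInt_cont. }
assert (E : RInt f (2 * PI) (2 * PI + c) = RInt f 0 c).
{ rewrite <- (RInt_ext (fun x => f (x + 2 * PI)) f 0 c) by (intros; apply Hp).
  rewrite RInt_shift by assumption. now rewrite Rplus_0_l, (Rplus_comm c). }
generalize (Hch 0 c (2 * PI + c)) (Hch 0 (2 * PI) (2 * PI + c)). lra.
Qed.

(** * Exponential moments of the cosine *)

(** [J 0] and [J 1] are [2 PI] times [I_0] and [I_1]. The index counts powers of the cosine, not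
    Bessel orders, so that differentiating in [y] only raises [k]. *)
Definition J (k : nat) (y : R) : R :=
  RInt (fun x => cos x ^ k * exp (y * cos x)) 0 (2 * PI).

Lemma J_derive (k : nat) (y : R) : is_derive (J k) y (J (S k) y).
Proof.
unfold J.
assert (D : forall z t, is_derive (fun u => cos t ^ k * exp (u * cos t)) z
    (cos t ^ S k * exp (z * cos t))).
{ intros z t. auto_derive; trivial. simpl. ring. }
rewrite <- (RInt_ext (fun t => Derive (fun u => cos t ^ k * exp (u * cos t)) y))
  by (intros; now apply is_derive_unique).
apply is_derive_RInt_param.
- apply filter_forall. intros z t _. now exists (cos t ^ S k * exp (z * cos t)).
- intros t _.
  apply continuity_2d_pt_ext with (f := fun u v => cos v ^ S k * exp (u * cos v)).
  { intros. symmetry. now apply is_derive_unique. }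
  assert (Hc : continuity_2d_pt (fun _ v => cos v) y t).
  { apply (continuity_1d_2d_pt_comp cos (fun _ v => v)).
    - apply continuity_cos.
    - apply continuity_2d_pt_id2. }
  apply continuity_2d_pt_mult.
  + apply (continuity_1d_2d_pt_comp (fun z => z ^ S k) (fun _ v => cos v)); trivial.
    apply derivable_continuous_pt, derivable_pt_pow.
  + apply (continuity_1d_2d_pt_comp exp (fun u v => u * cos v)).
    * apply derivable_continuous_pt, derivable_pt_exp.
    * apply continuity_2d_pt_mult; trivial. apply continuity_2d_pt_id1.
- apply filter_forall. intros z. apply ex_RInt_cont. continuous_by_derive.
Qed.

Lemma J0_pos (y : R) : 0 < J 0 y.
Proof.
apply RInt_gt_0.
- generalize PI_RGT_0; lra.
- intros x _. simpl. generalize (exp_pos (y * cos x)); lra.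
- intros. continuous_by_derive.
Qed.

Lemma sin2_moment (y : R) :
  RInt (fun x => sin x ^ 2 * exp (y * cos x)) 0 (2 * PI) = J 0 y - J 2 y.
Proof.
replace (J 0 y - J 2 y) with (1 * J 0 y + (-1) * J 2 y) by ring.
unfold J. rewrite <- RInt_lincomb by continuous_by_derive.
apply RInt_ext. intros x _. generalize (sin2_cos2 x). unfold Rsqr. simpl. intros H.
replace (sin x * (sin x * 1)) with (1 - cos x * cos x) by lra. ring.
Qed.

(** The derivative of [sin x * exp (y * cos x)] integrates to zero over a period. This is the source
    of every moment recurrence below. *)
Lemma J_by_parts (y : R) : y * (J 0 y - J 2 y) = J 1 y.
Proof.
assert (H : RInt (fun x => 1 * (cos x ^ 1 * exp (y * cos x))
                         + - y * (sin x ^ 2 * exp (y * cos x))) 0 (2 * PI) = 0).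
{ apply RInt_periodic_derive with (f := fun x => sin x * exp (y * cos x)).
  - intros x. auto_derive; trivial. ring.
  - continuous_by_derive.
  - rewrite sin_2PI, sin_0. ring. }
rewrite RInt_lincomb in H by continuous_by_derive.
rewrite sin2_moment in H. fold (J 1 y) in H. lra.
Qed.

Lemma sin_moment (y : R) : y <> 0 ->
  RInt (fun x => sin x * exp (y * cos x)) 0 (2 * PI) = 0.
Proof.
intros Hy.
apply RInt_periodic_derive with (f := fun x => - exp (y * cos x) / y).
- intros x. auto_derive; trivial. now field.
- continuous_by_derive.
- now rewrite cos_2PI, cos_0.
Qed.

(** A shift by half a period changes the sign of the cosine. *)
Lemma J_opp (k : nat) (y : R) : J k (- y) = (-1) ^ k * J k y.
Proof.
unfold J. rewrite <- RInt_scal_l by continuous_by_derive.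
rewrite <- (RInt_periodic_shift _ PI).
- apply RInt_ext. intros x _. rewrite neg_cos.
  replace (- y * - cos x) with (y * cos x) by ring.
  rewrite <- Rmult_assoc, <- Rpow_mult_distr. do 2 f_equal; ring.
- continuous_by_derive.
- intros x. now rewrite cos_plus, cos_2PI, sin_2PI, Rmult_1_r, Rmult_0_r, Rminus_0_r.
Qed.

Lemma abs_J1_le (y : R) : Rabs (J 1 y) <= J 0 y.
Proof.
assert (HPI := PI_RGT_0).
assert (E : forall u, (u = 1 \/ u = -1) -> u * J 1 y <= J 0 y).
{ intros u Hu. unfold J. rewrite <- RInt_scal_l by continuous_by_derive.
  apply RInt_le.
  - lra.
  - apply ex_RInt_cont. continuous_by_derive.
  - apply ex_RInt_cont. continuous_by_derive.
  - intros x _. rewrite <- Rmult_assoc. apply Rmult_le_compat_r.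
    + apply Rlt_le, exp_pos.
    + simpl. generalize (COS_bound x). destruct Hu; subst u; lra. }
apply Rabs_le. generalize (E 1 (or_introl eq_refl)) (E (-1) (or_intror eq_refl)). lra.
Qed.

(** * Rotating a planar field onto the first axis *)

Lemma polar_exists (a b : R) :
  exists phi, a = sqrt (a ^ 2 + b ^ 2) * cos phi /\ b = sqrt (a ^ 2 + b ^ 2) * sin phi.
Proof.
set (rho := sqrt (a ^ 2 + b ^ 2)).
assert (Hn : 0 <= a ^ 2 + b ^ 2) by nra.
assert (Hr : rho * rho = a ^ 2 + b ^ 2) by now apply sqrt_sqrt.
assert (Hr0 : 0 <= rho) by apply sqrt_pos.
destruct (Req_dec rho 0) as [E | E].
{ exists 0. rewrite E in *. split; nra. }
assert (Hb : -1 <= a / rho <= 1).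
{ split.
  - apply Rmult_le_reg_r with rho; [lra|].
    unfold Rdiv. rewrite Rmult_assoc, Rinv_l by assumption. nra.
  - apply Rmult_le_reg_r with rho; [lra|].
    unfold Rdiv. rewrite Rmult_assoc, Rinv_l by assumption. nra. }
assert (Hs : sqrt (1 - (a / rho)²) = Rabs b / rho).
{ replace (1 - (a / rho)²) with ((Rabs b / rho)²).
  - apply sqrt_Rsqr. apply Rmult_le_pos; [apply Rabs_pos|].
    apply Rlt_le, Rinv_0_lt_compat. lra.
  - rewrite !Rsqr_div', <- Rsqr_abs. unfold Rsqr. rewrite Hr. field. nra. }
destruct (Rle_dec 0 b) as [Hb0 | Hb0].
- exists (acos (a / rho)). rewrite cos_acos, sin_acos, Hs, Rabs_pos_eq by assumption.
  split; now field.
- exists (- acos (a / rho)).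
  rewrite cos_neg, sin_neg, cos_acos, sin_acos, Hs, Rabs_left by lra.
  split; now field.
Qed.

Lemma rotated_J0 (a b : R) :
  RInt (fun x => exp (a * cos x + b * sin x)) 0 (2 * PI) = J 0 (sqrt (a ^ 2 + b ^ 2)).
Proof.
destruct (polar_exists a b) as [phi [Ha Hb]].
set (rho := sqrt (a ^ 2 + b ^ 2)) in *. clearbody rho.
unfold J.
rewrite <- (RInt_periodic_shift (fun x => cos x ^ 0 * exp (rho * cos x)) (- phi)).
- apply RInt_ext. intros x _. simpl. rewrite Rmult_1_l. f_equal.
  rewrite Ha, Hb, cos_plus, cos_neg, sin_neg. ring.
- continuous_by_derive.
- intros x. now rewrite cos_plus, cos_2PI, sin_2PI, Rmult_1_r, Rmult_0_r, Rminus_0_r.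
Qed.

(** In coordinates rotated by [phi] only the component along the field survives; the orthogonal one
    vanishes by [sin_moment]. Writing [J 0 - J 2] instead of [J 1 / rho] keeps the formula valid at
    zero field. *)
Lemma rotated_J1 (a b u v : R) :
  RInt (fun x => (u * cos x + v * sin x) * exp (a * cos x + b * sin x)) 0 (2 * PI)
  = (J 0 (sqrt (a ^ 2 + b ^ 2)) - J 2 (sqrt (a ^ 2 + b ^ 2))) * (u * a + v * b) :> R.
Proof.
destruct (polar_exists a b) as [phi [Ha Hb]].
set (rho := sqrt (a ^ 2 + b ^ 2)) in *. clearbody rho.
destruct (Req_dec rho 0) as [E | E].
(* At zero field the integrand has the explicit periodic primitive [u sin x - v cos x]. *)
{ rewrite E, Rmult_0_l in Ha, Hb. rewrite Ha, Hb.
  replace (_ * (u * 0 + v * 0)) with 0 by ring.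
  apply RInt_periodic_derive
    with (f := fun x => (u * sin x - v * cos x) * exp (0 * cos x + 0 * sin x)).
  - intros x. auto_derive; trivial. ring.
  - continuous_by_derive.
  - rewrite sin_2PI, sin_0, cos_2PI, cos_0. reflexivity. }
rewrite <- (RInt_periodic_shift _ phi).
- rewrite (RInt_ext _ (fun x => (u * cos phi + v * sin phi) * (cos x ^ 1 * exp (rho * cos x))
    + (v * cos phi - u * sin phi) * (sin x * exp (rho * cos x)))).
  + rewrite RInt_lincomb by continuous_by_derive. fold (J 1 rho).
    rewrite sin_moment by assumption. rewrite <- J_by_parts.
    rewrite Ha, Hb. ring.
  + intros x _. replace (a * cos (x + phi) + b * sin (x + phi)) with (rho * cos x).
    * rewrite cos_plus, sin_plus. simpl. ring.
    * rewrite Ha, Hb, cos_plus, sin_plus.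
      replace (rho * cos x) with (rho * cos x * (Rsqr (sin phi) + Rsqr (cos phi)))
        by (rewrite sin2_cos2; ring).
      unfold Rsqr. ring.
- continuous_by_derive.
- intros x. rewrite cos_plus, sin_plus, cos_2PI, sin_2PI.
  now rewrite !Rmult_1_r, !Rmult_0_r, Rminus_0_r, Rplus_0_r.
Qed.

(** * The ratio of Bessel functions and its derivatives *)

Lemma strictly_increasing_on (f df : R -> R) (a b : R) :
  a < b -> (forall x, a <= x <= b -> is_derive f x (df x)) ->
  (forall x, a < x < b -> 0 < df x) -> f a < f b.
Proof.
intros Hab Hd Hp.
destruct (MVT_cor2 f df a b Hab) as [c [E Hc]].
{ intros c Hc. now apply is_derive_Reals, Hd. }
specialize (Hp c Hc). nra.
Qed.

(** Common engine of the sign results below: multiply by an integrating factor so that the quantity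
    vanishes at [0], then read off the sign of its derivative. Only [x > 0] is tested, since the
    recurrences divide by [x]. *)
Lemma positive_of_derive (f df : R -> R) (y : R) :
  f 0 = 0 -> (forall x, is_derive f x (df x)) ->
  (forall x, 0 < x -> 0 < df x) -> 0 < y -> 0 < f y.
Proof.
intros H0 Hd Hp Hy. rewrite <- H0.
apply strictly_increasing_on with df; intros; auto. apply Hp. lra.
Qed.

(** [A], [dA], [d2A], [d3A] are the first four cumulants of [cos x] under the density proportional
    to [exp (y * cos x)]. *)
Definition A (y : R) : R := J 1 y / J 0 y.
Definition dA (y : R) : R := J 2 y / J 0 y - (J 1 y / J 0 y) ^ 2.
Definition d2A (y : R) : R :=
  J 3 y / J 0 y - 3 * (J 2 y * J 1 y) / J 0 y ^ 2 + 2 * (J 1 y / J 0 y) ^ 3.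
Definition d3A (y : R) : R :=
  J 4 y / J 0 y - 4 * (J 3 y * J 1 y) / J 0 y ^ 2 - 3 * (J 2 y / J 0 y) ^ 2
  + 12 * (J 2 y * J 1 y ^ 2) / J 0 y ^ 3 - 6 * (J 1 y / J 0 y) ^ 4.

(* The mean of [sin^2]; equal to [A y / y], but regular at [0]. *)
Definition B (y : R) : R := 1 - J 2 y / J 0 y.

Lemma J0_neq_0 (y : R) : J 0 y <> 0.
Proof. apply Rgt_not_eq, J0_pos. Qed.

Ltac nonzero := repeat split; solve [apply J0_neq_0 | lra].

Lemma Derive_J (k : nat) (y : R) : Derive (fun x => J k x) y = J (S k) y.
Proof. apply is_derive_unique, J_derive. Qed.

Lemma ex_derive_J (k : nat) (y : R) : ex_derive (fun x => J k x) y.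
Proof. exists (J (S k) y). apply J_derive. Qed.

Ltac derive_J :=
  auto_derive;
  [ repeat split; try apply ex_derive_J; trivial; try apply J0_neq_0;
    simpl; rewrite ?Rmult_1_r; repeat apply Rmult_integral_contrapositive_currified;
    try apply J0_neq_0
  | rewrite ?Derive_J; try (field; try apply J0_neq_0) ].

Lemma A_derive (y : R) : is_derive A y (dA y).
Proof. unfold A, dA. derive_J. Qed.

Lemma dA_derive (y : R) : is_derive dA y (d2A y).
Proof. unfold dA, d2A. derive_J. Qed.

Lemma d2A_derive (y : R) : is_derive d2A y (d3A y).
Proof. unfold d2A, d3A. derive_J. Qed.

Lemma d3A_continuity : continuity d3A.
Proof.
intros y.
apply continuity_pt_filterlim, (@ex_derive_continuous R_AbsRing R_NormedModule).
unfold d3A. auto_derive.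
repeat split; try apply ex_derive_J; simpl; rewrite ?Rmult_1_r;
  repeat apply Rmult_integral_contrapositive_currified; apply J0_neq_0.
Qed.

(** * Moment recurrences and sign properties for positive argument *)

Lemma J2_eq (y : R) : 0 < y -> J 2 y = J 0 y - J 1 y / y.
Proof. intros Hy. rewrite <- (J_by_parts y). field. lra. Qed.

(** Derivative of [J_by_parts] in [y]; one more derivative yields [J4_eq]. Rewriting with [J4_eq],
    [J3_eq], [J2_eq] in this order leaves only [J 0] and [J 1]. *)
Lemma J_by_parts_derive (y : R) : J 0 y - J 2 y + y * (J 1 y - J 3 y) = J 2 y.
Proof.
transitivity (Derive (fun x => x * (J 0 x - J 2 x)) y).
- symmetry. apply is_derive_unique. derive_J.
- rewrite (Derive_ext _ (fun x => J 1 x)) by (intros; apply J_by_parts). apply Derive_J.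
Qed.

Lemma J3_eq (y : R) : 0 < y -> J 3 y = J 1 y - (2 * J 2 y - J 0 y) / y.
Proof.
intros Hy.
replace (2 * J 2 y - J 0 y) with (y * (J 1 y - J 3 y))
  by (generalize (J_by_parts_derive y); lra).
field. lra.
Qed.

Lemma J4_eq (y : R) : 0 < y -> J 4 y = J 2 y - (3 * J 3 y - 2 * J 1 y) / y.
Proof.
intros Hy.
assert (E : 2 * (J 1 y - J 3 y) + y * (J 2 y - J 4 y) = J 3 y).
{ transitivity (Derive (fun x => J 0 x - J 2 x + x * (J 1 x - J 3 x)) y).
  - symmetry. apply is_derive_unique. derive_J.
  - rewrite (Derive_ext _ (fun x => J 2 x)) by (intros; apply J_by_parts_derive).
    apply Derive_J. }
replace (3 * J 3 y - 2 * J 1 y) with (y * (J 2 y - J 4 y)) by lra.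
field. lra.
Qed.

(** The Bessel identity [(y I_1)' = y I_0] does it. *)
Lemma J1_pos (y : R) : 0 < y -> 0 < J 1 y.
Proof.
intros Hy.
enough (0 < y * J 1 y) by nra.
apply (positive_of_derive (fun x => x * J 1 x) (fun x => x * J 0 x)); trivial.
- ring.
- intros x. derive_J. generalize (J_by_parts x). lra.
- intros x Hx. generalize (J0_pos x). nra.
Qed.

Lemma A_eq (y : R) : A y = y * B y.
Proof.
unfold A, B. rewrite <- J_by_parts. field. apply J0_neq_0.
Qed.

Lemma B_pos (y : R) : 0 < y -> 0 < B y.
Proof.
intros Hy. unfold B. rewrite J2_eq by assumption.
replace (1 - _) with (J 1 y / (y * J 0 y)) by (field; nonzero).
apply Rdiv_lt_0_compat; [now apply J1_pos|].
generalize (J0_pos y); nra.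
Qed.

(** By the Riccati equation [B - A' = 2 A / y + A^2 - 1]; multiplied by [(y J0)^2] it has derivative
    [2 y J1^2]. *)
Lemma dA_lt_B (y : R) : 0 < y -> dA y < B y.
Proof.
intros Hy.
assert (H : 0 < 2 * y * J 0 y * J 1 y + y ^ 2 * J 1 y ^ 2 - y ^ 2 * J 0 y ^ 2).
{ apply (positive_of_derive
    (fun x => 2 * x * J 0 x * J 1 x + x ^ 2 * J 1 x ^ 2 - x ^ 2 * J 0 x ^ 2)
    (fun x => 2 * (J 0 x * J 1 x + x * (J 1 x ^ 2 + J 0 x * J 2 x))
      + 2 * x * (J 1 x ^ 2 - J 0 x ^ 2) + 2 * x ^ 2 * (J 1 x * J 2 x - J 0 x * J 1 x))); trivial.
  - ring.
  - intros x. derive_J.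
  - intros x Hx. rewrite J2_eq by assumption.
    replace (_ + _) with (2 * x * J 1 x ^ 2) by (field; lra).
    generalize (J1_pos x Hx). intros. apply Rmult_lt_0_compat; [lra|]. now apply pow_lt. }
apply Rlt_0_minus.
replace (B y - dA y)
  with ((2 * y * J 0 y * J 1 y + y ^ 2 * J 1 y ^ 2 - y ^ 2 * J 0 y ^ 2) / (y * J 0 y) ^ 2).
- apply Rdiv_lt_0_compat; trivial. apply pow_lt. generalize (J0_pos y); nra.
- unfold B, dA. rewrite J2_eq by assumption. field. nonzero.
Qed.

(** The function [y J0^2 A'] has derivative [J0 J1 / y]. *)
Lemma dA_pos (y : R) : 0 < y -> 0 < dA y.
Proof.
intros Hy.
assert (H : 0 < y * (J 2 y * J 0 y - J 1 y ^ 2)).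
{ apply (positive_of_derive (fun x => x * (J 2 x * J 0 x - J 1 x ^ 2))
    (fun x => J 2 x * J 0 x - J 1 x ^ 2 + x * (J 3 x * J 0 x - J 1 x * J 2 x))); trivial.
  - ring.
  - intros x. derive_J.
  - intros x Hx. rewrite J3_eq, J2_eq by assumption.
    replace (_ + _) with (J 0 x * J 1 x / x) by (field; lra).
    generalize (J1_pos x Hx) (J0_pos x). intros.
    apply Rdiv_lt_0_compat; trivial. nra. }
replace (dA y) with (y * (J 2 y * J 0 y - J 1 y ^ 2) / (y * J 0 y ^ 2)).
- apply Rdiv_lt_0_compat; trivial.
  apply Rmult_lt_0_compat; trivial. apply pow_lt, J0_pos.
- unfold dA. field. nonzero.
Qed.

(* Differentiating the Riccati equation [A' = 1 - A / y - A^2] twice gives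
   [A''' + (1 / y + 2 A) A'' = - 2 A'^2 - 2 (A / y - A') / y^2 < 0];
   [y J0^2] is an integrating factor. *)
Lemma d2A_neg (y : R) : 0 < y -> d2A y < 0.
Proof.
intros Hy.
assert (H : 0 < - y * (J 3 y * J 0 y - 3 * J 2 y * J 1 y + 2 * J 1 y ^ 3 / J 0 y)).
{ apply (positive_of_derive
    (fun x => - x * (J 3 x * J 0 x - 3 * J 2 x * J 1 x + 2 * J 1 x ^ 3 / J 0 x))
    (fun x => - (J 3 x * J 0 x - 3 * J 2 x * J 1 x + 2 * J 1 x ^ 3 / J 0 x)
      - x * (J 4 x * J 0 x - 2 * J 3 x * J 1 x - 3 * J 2 x ^ 2
             + 6 * J 1 x ^ 2 * J 2 x / J 0 x - 2 * J 1 x ^ 4 / J 0 x ^ 2))); trivial.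
  - ring.
  - intros x. derive_J.
  - intros x Hx.
    replace (_ - _) with (2 * x * J 0 x ^ 2 * dA x ^ 2 + 2 / x * J 0 x ^ 2 * (B x - dA x)).
    + generalize (dA_pos x Hx) (dA_lt_B x Hx) (pow_lt _ 2 (J0_pos x)). intros HA HB HJ.
      apply Rplus_lt_0_compat.
      * apply Rmult_lt_0_compat; [nra | now apply pow_lt].
      * apply Rmult_lt_0_compat; [|lra]. apply Rmult_lt_0_compat; trivial.
        apply Rdiv_lt_0_compat; lra.
    + unfold dA, B. rewrite J4_eq, J3_eq, J2_eq by assumption.
      field. nonzero. }
apply Ropp_lt_cancel. rewrite Ropp_0.
replace (- d2A y) with
  (- y * (J 3 y * J 0 y - 3 * J 2 y * J 1 y + 2 * J 1 y ^ 3 / J 0 y) / (y * J 0 y ^ 2)).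
- apply Rdiv_lt_0_compat; trivial.
  apply Rmult_lt_0_compat; trivial. apply pow_lt, J0_pos.
- unfold d2A. field. nonzero.
Qed.

Lemma dA_decreasing (x y : R) : 0 < x < y -> dA y < dA x.
Proof.
intros Hxy.
apply Ropp_lt_cancel.
apply (strictly_increasing_on (fun z => - dA z) (fun z => - d2A z)); try lra.
- intros z _. apply (is_derive_opp (V := R_NormedModule) dA), dA_derive.
- intros z Hz. assert (Hz0 : 0 < z) by lra. generalize (d2A_neg z Hz0). lra.
Qed.

Lemma B_derive (y : R) : is_derive B y (J 1 y * J 2 y / J 0 y ^ 2 - J 3 y / J 0 y).
Proof. unfold B. derive_J. Qed.

(** Differentiating [A = y B] gives [- B' = (B - A') / y], which is positive by [dA_lt_B]. *)
Lemma B_decreasing (x y : R) : 0 <= x < y -> B y < B x.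
Proof.
intros Hxy.
apply Ropp_lt_cancel.
apply (strictly_increasing_on (fun z => - B z)
  (fun z => - (J 1 z * J 2 z / J 0 z ^ 2 - J 3 z / J 0 z))); try lra.
- intros z _. apply (is_derive_opp (V := R_NormedModule) B), B_derive.
- intros z Hz. assert (Hz0 : 0 < z) by lra.
  replace (- _) with ((B z - dA z) / z).
  + apply Rdiv_lt_0_compat; trivial. generalize (dA_lt_B z Hz0). lra.
  + unfold B, dA. rewrite J3_eq, J2_eq by assumption.
    field. nonzero.
Qed.

Lemma B_inj (x y : R) : 0 <= x -> 0 <= y -> B x = B y -> x = y.
Proof.
intros Hx Hy E. destruct (Rtotal_order x y) as [H | [H | H]]; trivial.
- generalize (B_decreasing x y (conj Hx H)). lra.
- generalize (B_decreasing y x (conj Hy H)). lra.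
Qed.

Lemma B_opp (y : R) : B (- y) = B y.
Proof. unfold B. rewrite !J_opp. simpl. field. apply J0_neq_0. Qed.

Lemma B_abs (y : R) : B (Rabs y) = B y.
Proof. unfold Rabs. destruct (Rcase_abs y); trivial. apply B_opp. Qed.

Lemma A_opp (y : R) : A (- y) = - A y.
Proof. rewrite !A_eq, B_opp. ring. Qed.

Lemma A_bound (y : R) : -1 <= A y <= 1.
Proof.
generalize (abs_J1_le y) (J0_pos y). intros H HJ.
apply Rabs_le_between in H. unfold A.
split; apply Rmult_le_reg_r with (J 0 y); trivial;
  unfold Rdiv; rewrite Rmult_assoc, Rinv_l by lra; lra.
Qed.

(** Mean value slopes on the two sides of [t] are compared through [dA_decreasing]; [a < t] keeps
    both mean value points positive. *)
Lemma A_midpoint_concave (a t : R) : 0 < a < t -> A (t + a) + A (t - a) < 2 * A t.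
Proof.
intros Hat.
assert (HA : forall z, derivable_pt_lim A z (dA z))
  by (intros; apply is_derive_Reals, A_derive).
destruct (MVT_cor2 A dA t (t + a)) as [c [Ec Hc]]; [lra | auto |].
destruct (MVT_cor2 A dA (t - a) t) as [d [Ed Hd]]; [lra | auto |].
assert (H : dA c < dA d) by (apply dA_decreasing; lra).
nra.
Qed.

(* For [t <= a] monotonicity of [B] suffices; for [t > a] concavity first reduces to [2 A t]. *)
Lemma A_odd_part_lt (a t : R) : 0 < a -> 0 < t -> A (t + a) + A (t - a) < 2 * t * B a.
Proof.
intros Ha Ht.
assert (H : B (t + a) < B a) by (apply B_decreasing; lra).
destruct (Rle_dec t a) as [Hta | Hta].
- replace (t - a) with (- (a - t)) by ring. rewrite A_opp, !A_eq.
  destruct (Req_dec t a) as [E | E].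
  + subst t. replace (a - a) with 0 by ring. nra.
  + assert (H' : B a < B (a - t)) by (apply B_decreasing; lra). nra.
- assert (H' : B t < B a) by (apply B_decreasing; lra).
  generalize (A_midpoint_concave a t). rewrite (A_eq t). nra.
Qed.

(** * Reduction of the self-consistency relation *)

(* Modulus of the field [2 (theta r e^{i Psi} + h eta)] acting on a spin of type [eta]. *)
Definition rho (theta h r Psi eta : R) : R :=
  sqrt ((2 * (theta * r * cos Psi + h * eta)) ^ 2 + (2 * (theta * r * sin Psi)) ^ 2).

Lemma wgt_eq (theta h r Psi x eta : R) :
  wgt theta h r Psi x eta =
  exp (2 * (theta * r * cos Psi + h * eta) * cos x + 2 * (theta * r * sin Psi) * sin x).
Proof. unfold wgt. rewrite cos_minus. f_equal. ring. Qed.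

Lemma Zpart_eq (theta h r Psi eta : R) :
  Zpart theta h r Psi eta = J 0 (rho theta h r Psi eta).
Proof.
unfold Zpart, rho. rewrite <- rotated_J0. apply RInt_ext. intros; apply wgt_eq.
Qed.

(** The coefficients [u], [v] let the cosine and sine means come from a single rotated integral. *)
Lemma q_mean (theta h r Psi eta u v : R) :
  RInt (fun x => (u * cos x + v * sin x) * q theta h r Psi x eta) 0 (2 * PI) =
  B (rho theta h r Psi eta) *
  (u * (2 * (theta * r * cos Psi + h * eta)) + v * (2 * (theta * r * sin Psi))) :> R.
Proof.
set (a := 2 * (theta * r * cos Psi + h * eta)).
set (b := 2 * (theta * r * sin Psi)).
rewrite (RInt_ext _ (fun x => / J 0 (rho theta h r Psi eta) *
  ((u * cos x + v * sin x) * exp (a * cos x + b * sin x)))).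
- rewrite RInt_scal_l by continuous_by_derive. rewrite rotated_J1.
  unfold B, rho. fold a b. field. apply J0_neq_0.
- intros x _. unfold q. rewrite Zpart_eq, wgt_eq. fold a b. simpl. field. apply J0_neq_0.
Qed.

(** The planar system of the self-consistency relation; the weight [1/2] of [mu_int] cancels the
    factor [2] in the field. *)
Lemma ferro_iff (theta h r Psi : R) :
  ferro theta h r Psi <->
  0 < r /\ 0 <= Psi < 2 * PI /\
  r * cos Psi = B (rho theta h r Psi 1) * (theta * r * cos Psi + h)
              + B (rho theta h r Psi (-1)) * (theta * r * cos Psi - h) /\
  r * sin Psi = (B (rho theta h r Psi 1) + B (rho theta h r Psi (-1)))
              * (theta * r * sin Psi).
Proof.
assert (Ec : forall eta, RInt (fun x => cos x * q theta h r Psi x eta) 0 (2 * PI) =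
  B (rho theta h r Psi eta) * (2 * (theta * r * cos Psi + h * eta)) :> R).
{ intros eta. transitivity
    (RInt (fun x => (1 * cos x + 0 * sin x) * q theta h r Psi x eta) 0 (2 * PI)).
  - apply RInt_ext. intros x _. simpl. ring.
  - rewrite q_mean. ring. }
assert (Es : forall eta, RInt (fun x => sin x * q theta h r Psi x eta) 0 (2 * PI) =
  B (rho theta h r Psi eta) * (2 * (theta * r * sin Psi)) :> R).
{ intros eta. transitivity
    (RInt (fun x => (0 * cos x + 1 * sin x) * q theta h r Psi x eta) 0 (2 * PI)).
  - apply RInt_ext. intros x _. simpl. ring.
  - rewrite q_mean. ring. }
unfold ferro, mu_int. rewrite !Ec, !Es.
split; intros (H1 & H2 & H3 & H4); (split; [|split; [|split]]); trivial; lra.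
Qed.

(** Since [A] is odd, [cos Psi = 1] and [cos Psi = -1] lead to the same scalar equation, so one root
    serves both [0] and [PI]. *)
Lemma ferro_axis_iff (theta h r Psi : R) :
  0 <= Psi < 2 * PI -> sin Psi = 0 ->
  ferro theta h r Psi <->
  0 < r /\ 2 * r = A (2 * (h + theta * r)) - A (2 * (h - theta * r)).
Proof.
intros HP Hs.
assert (Hc : cos Psi = 1 \/ cos Psi = -1).
{ generalize (sin2_cos2 Psi). rewrite Hs. unfold Rsqr. intros H.
  assert (E : (cos Psi - 1) * (cos Psi + 1) = 0) by lra.
  apply Rmult_integral in E. lra. }
(* On the axis [rho] is an absolute value, which the even function [B] ignores. *)
assert (HB : forall eta, B (rho theta h r Psi eta) * (2 * (theta * r * cos Psi + h * eta)) =
  A (2 * (theta * r * cos Psi + h * eta))).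
{ intros eta. unfold rho. rewrite Hs.
  replace (_ + (2 * (theta * r * 0)) ^ 2) with ((2 * (theta * r * cos Psi + h * eta))²)
    by (unfold Rsqr; ring).
  rewrite sqrt_Rsqr_abs, B_abs, A_eq. ring. }
generalize (HB 1) (HB (-1)). clear HB. intros HB1 HB2.
rewrite ferro_iff, Hs.
assert (E : r * cos Psi = B (rho theta h r Psi 1) * (theta * r * cos Psi + h)
              + B (rho theta h r Psi (-1)) * (theta * r * cos Psi - h) <->
  2 * r * cos Psi = A (2 * (theta * r * cos Psi + h)) + A (2 * (theta * r * cos Psi - h))).
{ replace (h * 1) with h in HB1 by ring.
  replace (theta * r * cos Psi + h * -1) with (theta * r * cos Psi - h) in HB2 by ring.
  split; lra. }
rewrite E. clear E HB1 HB2.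
assert (E : 2 * r * cos Psi = A (2 * (theta * r * cos Psi + h)) + A (2 * (theta * r * cos Psi - h))
  <-> 2 * r = A (2 * (h + theta * r)) - A (2 * (h - theta * r))).
{ destruct Hc as [Hc | Hc]; rewrite Hc.
  - replace (2 * (theta * r * 1 - h)) with (- (2 * (h - theta * r))) by ring.
    replace (theta * r * 1 + h) with (h + theta * r) by ring.
    rewrite A_opp. split; lra.
  - replace (2 * (theta * r * -1 - h)) with (- (2 * (h + theta * r))) by ring.
    replace (theta * r * -1 + h) with (h - theta * r) by ring.
    rewrite A_opp. split; lra. }
rewrite E. split.
- intros (H1 & _ & H2 & _). now split.
- intros (H1 & H2). repeat split; trivial; lra.
Qed.

Lemma rho_transverse (theta h r Psi eta : R) :
  cos Psi = 0 -> eta ^ 2 = 1 ->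
  rho theta h r Psi eta = 2 * sqrt ((theta * r) ^ 2 + h ^ 2).
Proof.
intros Hc He. unfold rho. rewrite Hc.
replace (_ + _) with (2 ^ 2 * ((theta * r) ^ 2 + h ^ 2)).
- rewrite sqrt_mult_alt, sqrt_pow2 by nra. reflexivity.
- generalize (sin2_cos2 Psi). rewrite Hc. unfold Rsqr. intros H.
  replace ((2 * (theta * r * 0 + h * eta)) ^ 2 + (2 * (theta * r * sin Psi)) ^ 2)
    with (2 ^ 2 * ((theta * r) ^ 2 * (sin Psi * sin Psi) + h ^ 2 * eta ^ 2)) by ring.
  rewrite He. replace (sin Psi * sin Psi) with 1 by lra. ring.
Qed.

(** Both spin types feel fields of equal modulus, so the [h] terms cancel in the cosine equation and
    the sine equation alone remains. *)
Lemma ferro_transverse (theta h r Psi : R) :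
  0 < r -> 0 <= Psi < 2 * PI -> cos Psi = 0 ->
  2 * theta * B (2 * sqrt ((theta * r) ^ 2 + h ^ 2)) = 1 -> ferro theta h r Psi.
Proof.
intros Hr HP Hc HB. apply ferro_iff.
rewrite !rho_transverse by (trivial; ring). rewrite Hc.
repeat split; try lra.
transitivity (r * sin Psi * (2 * theta * B (2 * sqrt ((theta * r) ^ 2 + h ^ 2)))).
- rewrite HB. ring.
- ring.
Qed.

(** * The critical couplings and the transverse solutions *)

Lemma q0_eq (h x : R) : q0 h x = exp (2 * h * cos x) / J 0 (2 * h).
Proof.
unfold q0, J. apply f_equal, RInt_ext. intros y _. simpl. ring.
Qed.

Lemma q0_moment (h : R) (f : R -> R) :
  (forall x, continuous f x) ->
  RInt (fun x => f x * q0 h x) 0 (2 * PI) =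
  / J 0 (2 * h) * RInt (fun x => f x * exp (2 * h * cos x)) 0 (2 * PI) :> R.
Proof.
intros Hf. rewrite <- RInt_scal_l.
- apply RInt_ext. intros x _. rewrite q0_eq. simpl. field. apply J0_neq_0.
- intros x. apply (continuous_mult (K := R_AbsRing)); trivial. continuous_by_derive.
Qed.

Lemma theta1_eq (h : R) : theta1 h = / 2 * / B (2 * h).
Proof.
unfold theta1. rewrite (q0_moment h (fun x => sin x ^ 2)) by continuous_by_derive.
rewrite sin2_moment. do 2 f_equal. unfold B. field. apply J0_neq_0.
Qed.

Lemma theta2_eq (h : R) : theta2 h = / 2 * / dA (2 * h).
Proof.
unfold theta2. rewrite (q0_moment h (fun x => cos x ^ 2)) by continuous_by_derive.
rewrite (q0_moment h cos) by continuous_by_derive.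
rewrite (RInt_ext (fun x => cos x * exp (2 * h * cos x))
  (fun x => cos x ^ 1 * exp (2 * h * cos x))) by (intros; simpl; ring).
fold (J 1 (2 * h)) (J 2 (2 * h)).
do 2 f_equal. unfold dA. field. apply J0_neq_0.
Qed.

Lemma theta1_lt_theta2 (h : R) : 0 < h -> theta1 h < theta2 h.
Proof.
intros Hh. rewrite theta1_eq, theta2_eq.
assert (H1 : 0 < dA (2 * h)) by (apply dA_pos; lra).
assert (H2 : dA (2 * h) < B (2 * h)) by (apply dA_lt_B; lra).
apply Rmult_lt_compat_l; [lra|]. apply Rinv_lt_contravar; nra.
Qed.

Lemma half_inv_lt (u theta : R) : 0 < u -> / 2 * / u < theta <-> 1 < 2 * theta * u.
Proof.
intros Hu.
assert (E : 2 * theta * u - 1 = 2 * u * (theta - / 2 * / u)) by (field; lra).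
split; intros H; nra.
Qed.

Lemma theta1_lt_iff (h theta : R) : 0 < h -> theta1 h < theta <-> 1 < 2 * theta * B (2 * h).
Proof. intros Hh. rewrite theta1_eq. apply half_inv_lt, B_pos. lra. Qed.

Lemma theta2_lt_iff (h theta : R) : 0 < h -> theta2 h < theta <-> 1 < 2 * theta * dA (2 * h).
Proof. intros Hh. rewrite theta2_eq. apply half_inv_lt, dA_pos. lra. Qed.

Lemma no_ferro (theta h r Psi : R) :
  0 < h -> 0 < theta -> theta <= theta1 h -> ~ ferro theta h r Psi.
Proof.
intros Hh Ht Hle HF.
assert (Hle' : 2 * theta * B (2 * h) <= 1).
{ apply Rnot_lt_le. rewrite <- theta1_lt_iff by assumption. lra. }
assert (HFi := HF). apply ferro_iff in HFi. destruct HFi as (Hr & HP & HX & HY).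
assert (Htr : 0 < theta * r) by nra.
destruct (Req_dec (sin Psi) 0) as [Hs | Hs].
- apply ferro_axis_iff in HF; trivial. destruct HF as [_ HF].
  (* Aligned case: this bound gives [2 r < 2 r (2 theta B (2 h))], whose right-hand side is at most
     [2 r]. *)
  generalize (A_odd_part_lt (2 * h) (2 * (theta * r))). intros H.
  replace (2 * (theta * r) - 2 * h) with (- (2 * (h - theta * r))) in H by ring.
  replace (2 * (theta * r) + 2 * h) with (2 * (h + theta * r)) in H by ring.
  rewrite A_opp in H.
  assert (r * (2 * theta * B (2 * h)) <= r * 1) by (apply Rmult_le_compat_l; lra).
  specialize (H ltac:(lra) ltac:(lra)). lra.
- set (Bp := B (rho theta h r Psi 1)) in *. set (Bm := B (rho theta h r Psi (-1))) in *.
  (* Dividing the sine equation by [r sin Psi]; inserted in the cosine equation this leaves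
     [h (Bp - Bm) = 0]. *)
  assert (E : theta * (Bp + Bm) = 1).
  { apply Rmult_eq_reg_l with (r * sin Psi); [lra|].
    apply Rmult_integral_contrapositive_currified; lra. }
  assert (EB : Bp = Bm).
  { assert (E' : h * (Bp - Bm) = 0).
    { replace (h * (Bp - Bm)) with
        (r * cos Psi - r * cos Psi * (theta * (Bp + Bm))) by lra. rewrite E. ring. }
    apply Rmult_integral in E'. lra. }
  assert (Hc : cos Psi = 0).
  (* The two squared moduli differ by [16 theta r h cos Psi]. *)
  { assert (ER : rho theta h r Psi 1 = rho theta h r Psi (-1))
      by (apply B_inj; trivial; apply sqrt_pos).
    apply sqrt_inj in ER; try (apply Rplus_le_le_0_compat; apply pow2_ge_0).
    assert (E' : theta * r * h * cos Psi = 0) by lra.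
    apply Rmult_integral in E'. destruct E' as [E' | E']; trivial. nra. }
  assert (HB : Bp < B (2 * h)).
  { unfold Bp. rewrite rho_transverse by (trivial; ring). apply B_decreasing. split; [lra|].
    apply Rmult_lt_compat_l; [lra|].
    rewrite <- (sqrt_pow2 h) at 1 by lra. apply sqrt_lt_1; nra. }
  nra.
Qed.

Lemma exists_transverse (theta h : R) :
  0 < h -> 0 < theta -> theta1 h < theta ->
  exists r, ferro theta h r (PI / 2) /\ ferro theta h r (3 * PI / 2).
Proof.
intros Hh Ht Hlt. apply theta1_lt_iff in Hlt; trivial.
assert (HPI := PI_RGT_0).
(* An endpoint beyond [2 theta]: there [y B y = A y <= 1] forces [2 theta B y < 1]. *)
set (y := 2 * theta + 2 * h).
assert (Hy : 2 * theta * B y < 1).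
{ generalize (A_bound y). rewrite A_eq. intros [_ H].
  assert (0 < B y) by (apply B_pos; unfold y; lra). unfold y in *. nra. }
destruct (IVT_cor (fun z => 2 * theta * B z - 1) (2 * h) y) as [z [Hz Ez]].
- intros z. apply continuity_pt_minus; [|apply continuity_pt_const; now intros ? ?].
  apply continuity_pt_mult; [apply continuity_pt_const; now intros ? ?|].
  apply continuity_pt_filterlim, (@ex_derive_continuous R_AbsRing R_NormedModule).
  eexists. apply B_derive.
- unfold y. lra.
- nra.
- assert (Hz' : 2 * h < z).
  { destruct (Req_dec z (2 * h)) as [E | E]; [rewrite E in Ez|]; lra. }
  assert (Hd : 0 < (z / 2) ^ 2 - h ^ 2) by nra.
  (* Solves [z = 2 sqrt ((theta r)^2 + h^2)] for [r]. *)
  set (r := sqrt ((z / 2) ^ 2 - h ^ 2) / theta).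
  assert (Hr : 0 < r) by (apply Rdiv_lt_0_compat; trivial; now apply sqrt_lt_R0).
  assert (E : 2 * theta * B (2 * sqrt ((theta * r) ^ 2 + h ^ 2)) = 1).
  { replace (theta * r) with (sqrt ((z / 2) ^ 2 - h ^ 2)) by (unfold r; field; lra).
    rewrite pow2_sqrt by lra.
    replace ((z / 2) ^ 2 - h ^ 2 + h ^ 2) with ((z / 2) ^ 2) by ring.
    rewrite sqrt_pow2 by lra. replace (2 * (z / 2)) with z by field. lra. }
  exists r. split; apply ferro_transverse; trivial; try lra.
  + apply cos_PI2.
  + replace (3 * PI / 2) with (3 * (PI / 2)) by field. apply cos_3PI2.
Qed.

(** * Solutions aligned with the random field *)

(** With [s = theta r] the aligned equation reads [odd_part h s = 2 s / theta], so the coupling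
    enters only as the slope of a line. *)
Definition odd_part (h s : R) : R := A (2 * (h + s)) - A (2 * (h - s)).

Lemma odd_part_0 (h : R) : odd_part h 0 = 0.
Proof. unfold odd_part. rewrite Rplus_0_r, Rminus_0_r. ring. Qed.

Lemma odd_part_derive (h s : R) :
  is_derive (odd_part h) s (2 * (dA (2 * (h + s)) + dA (2 * (h - s)))).
Proof.
unfold odd_part. auto_derive.
- repeat split; eexists; apply A_derive.
- rewrite (is_derive_unique (fun x : R => A x) _ _ (A_derive (2 * (h + s)))).
  rewrite (is_derive_unique (fun x : R => A x) _ _ (A_derive (2 * (h + - s)))).
  unfold Rminus. ring.
Qed.

Lemma odd_part_derive_2 (h s : R) :
  is_derive (fun s => 2 * (dA (2 * (h + s)) + dA (2 * (h - s)))) s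
    (4 * (d2A (2 * (h + s)) - d2A (2 * (h - s)))).
Proof.
auto_derive.
- repeat split; eexists; apply dA_derive.
- rewrite (is_derive_unique (fun x : R => dA x) _ _ (dA_derive (2 * (h + s)))).
  rewrite (is_derive_unique (fun x : R => dA x) _ _ (dA_derive (2 * (h + - s)))).
  unfold Rminus. ring.
Qed.

Lemma odd_part_derive_3 (h s : R) :
  is_derive (fun s => 4 * (d2A (2 * (h + s)) - d2A (2 * (h - s)))) s
    (8 * (d3A (2 * (h + s)) + d3A (2 * (h - s)))).
Proof.
auto_derive.
- repeat split; eexists; apply d2A_derive.
- rewrite (is_derive_unique (fun x : R => d2A x) _ _ (d2A_derive (2 * (h + s)))).
  rewrite (is_derive_unique (fun x : R => d2A x) _ _ (d2A_derive (2 * (h + - s)))).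
  unfold Rminus. ring.
Qed.

Lemma bessel_ratio (y : R) : besselI 1 y / besselI 0 y = A y.
Proof.
assert (HPI := PI_RGT_0).
unfold besselI, A.
rewrite (RInt_ext (fun a => cos (1 * a) * _) (fun a => cos a ^ 1 * exp (y * cos a)))
  by (intros; rewrite Rmult_1_l; simpl; ring).
rewrite (RInt_ext (fun a => cos (0 * a) * _) (fun a => cos a ^ 0 * exp (y * cos a)))
  by (intros; rewrite Rmult_0_l, cos_0; simpl; ring).
fold (J 0 y) (J 1 y). field. nonzero.
Qed.

(** Translates the condition defining [hbar], at [theta = 1], into a zero of [d3A]: three chain-rule
    factors [2], and two equal terms at [r = 0]. *)
Lemma D3_eq (h : R) : D3 1 h = 16 * d3A (2 * h).
Proof.
unfold D3.
rewrite (Derive_n_ext _ (odd_part h)).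
2: { intros s. now rewrite !bessel_ratio, Rmult_1_l. }
simpl.
rewrite (Derive_ext _ (fun s => 4 * (d2A (2 * (h + s)) - d2A (2 * (h - s))))).
- transitivity (8 * (d3A (2 * (h + 0)) + d3A (2 * (h - 0)))).
  + apply is_derive_unique, odd_part_derive_3.
  + rewrite Rplus_0_r, Rminus_0_r. ring.
- intros s.
  rewrite (Derive_ext _ (fun s => 2 * (dA (2 * (h + s)) + dA (2 * (h - s))))).
  + apply is_derive_unique, odd_part_derive_2.
  + intros t. apply is_derive_unique, odd_part_derive.
Qed.

(* Otherwise [A'] would be concave and decreasing from [y0] on, hence negative somewhere. *)
Lemma d3A_pos_beyond (y0 : R) :
  0 < y0 -> (forall y, y0 <= y -> d3A y <> 0) -> 0 < d3A y0.
Proof.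
intros Hy0 Hnz.
destruct (Rlt_dec 0 (d3A y0)) as [H | H]; trivial. exfalso.
assert (Hneg : forall y, y0 <= y -> d3A y < 0).
{ intros y Hy.
  destruct (Rlt_dec (d3A y) 0) as [Hn | Hn]; trivial. exfalso.
  destruct (IVT_cor d3A y0 y d3A_continuity Hy) as [z [Hz Ez]]; [nra|].
  apply (Hnz z); lra. }
assert (H2 := d2A_neg y0 Hy0). assert (H1 := dA_pos y0 Hy0).
(* The zero of the tangent to [A'] at [y0]; strict concavity puts [A'] below that tangent. *)
set (y := y0 + dA y0 / - d2A y0).
assert (Hy : y0 < y).
{ unfold y. assert (0 < dA y0 / - d2A y0) by (apply Rdiv_lt_0_compat; lra). lra. }
destruct (MVT_cor2 dA d2A y0 y Hy) as [c [Ec Hc]].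
{ intros; apply is_derive_Reals, dA_derive. }
destruct (MVT_cor2 d2A d3A y0 c) as [d [Ed Hd]]; [lra| |].
{ intros; apply is_derive_Reals, d2A_derive. }
assert (H3 : d3A d < 0) by (apply Hneg; lra).
assert (Hc2 : d2A c < d2A y0) by nra.
assert (Hy1 : 0 < dA y) by (apply dA_pos; lra).
assert (E : d2A y0 * (y - y0) = - dA y0) by (unfold y; field; lra).
nra.
Qed.

(** Near [2 h] the function [d2A] increases, so the second derivative of [odd_part] is positive just
    right of [0] and its slope exceeds the initial value [4 dA (2 h)]. *)
Lemma odd_part_above_tangent (h : R) :
  0 < d3A (2 * h) -> exists s, 0 < s /\ 4 * dA (2 * h) * s < odd_part h s.
Proof.
intros H3.
assert (Hloc : exists d, 0 < d /\ forall y, Rabs (y - 2 * h) < d -> 0 < d3A y).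
{ destruct (d3A_continuity (2 * h) (d3A (2 * h)) H3) as [d [Hd H]].
  exists d. split; trivial. intros y Hy.
  destruct (Req_dec y (2 * h)) as [E | E]; [now rewrite E|].
  assert (HH : Rabs (d3A y - d3A (2 * h)) < d3A (2 * h)).
  { apply H. repeat split; trivial. now apply not_eq_sym. }
  apply Rabs_lt_between in HH. lra. }
destruct Hloc as [d [Hd Hpos]].
(* For [s < d / 2] both points [2 (h + s)] and [2 (h - s)] lie within [d] of [2 h]. *)
assert (Hp : forall s, 0 < s < d / 2 ->
  4 * dA (2 * h) < 2 * (dA (2 * (h + s)) + dA (2 * (h - s)))).
{ intros s Hs.
  generalize (strictly_increasing_on _ _ 0 s (proj1 Hs) (fun x _ => odd_part_derive_2 h x)).
  simpl. rewrite Rplus_0_r, Rminus_0_r. intros H.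
  replace (4 * dA (2 * h)) with (2 * (dA (2 * h) + dA (2 * h))) by ring.
  apply H. intros x Hx.
  assert (d2A (2 * (h - x)) < d2A (2 * (h + x))); [|lra].
  apply (strictly_increasing_on d2A d3A); [lra | intros; apply d2A_derive |].
  intros y Hy. apply Hpos. apply Rabs_lt_between. lra. }
exists (d / 4). split; [lra|].
enough (odd_part h 0 - 4 * dA (2 * h) * 0 < odd_part h (d / 4) - 4 * dA (2 * h) * (d / 4))
  by (rewrite odd_part_0 in *; lra).
apply (strictly_increasing_on (fun s => odd_part h s - 4 * dA (2 * h) * s)
  (fun s => 2 * (dA (2 * (h + s)) + dA (2 * (h - s))) - 4 * dA (2 * h))); [lra| |].
- intros s _.
  apply (is_derive_minus (V := R_NormedModule) (odd_part h)); [apply odd_part_derive|].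
  auto_derive; trivial. ring.
- intros s Hs. generalize (Hp s). lra.
Qed.

Lemma positive_right_of_0 (f : R -> R) (d e : R) :
  is_derive f 0 d -> f 0 = 0 -> 0 < d -> 0 < e -> exists s, 0 < s < e /\ 0 < f s.
Proof.
intros Hf H0 Hd He.
(* The tolerance is the derivative [d] itself, so the difference quotient stays positive. *)
apply is_derive_Reals in Hf. destruct (Hf d Hd) as [del Hdel].
assert (Hdel0 := cond_pos del).
set (s := Rmin (del / 2) (e / 2)).
assert (Hs : 0 < s) by (unfold s; apply Rmin_glb_lt; lra).
assert (Hs1 : s <= del / 2) by apply Rmin_l.
assert (Hs2 : s <= e / 2) by apply Rmin_r.
exists s. split; [lra|].
generalize (Hdel s ltac:(lra) ltac:(rewrite Rabs_pos_eq; lra)).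
rewrite Rplus_0_l, H0, Rminus_0_r. intros H. apply Rabs_lt_between in H.
assert (Hq : 0 < f s / s) by lra.
replace (f s) with (f s / s * s) by (field; lra). nra.
Qed.

(** Its positive roots [s] are the aligned solutions, with [r = s / theta]. *)
Definition excess (theta h s : R) : R := odd_part h s - 2 / theta * s.

Lemma excess_0 (theta h : R) : excess theta h 0 = 0.
Proof. unfold excess. rewrite odd_part_0. ring. Qed.

Lemma excess_derive (theta h s : R) :
  is_derive (excess theta h) s (2 * (dA (2 * (h + s)) + dA (2 * (h - s))) - 2 / theta).
Proof.
apply (is_derive_minus (V := R_NormedModule) (odd_part h)); [apply odd_part_derive|].
auto_derive; trivial. ring.
Qed.

Lemma excess_derive_0 (theta h : R) :
  is_derive (excess theta h) 0 (4 * dA (2 * h) - 2 / theta).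
Proof.
generalize (excess_derive theta h 0). rewrite Rplus_0_r, Rminus_0_r.
now replace (2 * (dA (2 * h) + dA (2 * h))) with (4 * dA (2 * h)) by ring.
Qed.

Lemma excess_far (theta h : R) : 0 < theta -> excess theta h (2 * theta) < 0.
Proof.
intros Ht. unfold excess, odd_part.
generalize (A_bound (2 * (h + 2 * theta))) (A_bound (2 * (h - 2 * theta))).
replace (2 / theta * (2 * theta)) with 4 by (field; lra). lra.
Qed.

Lemma axis_root (theta h a b : R) :
  0 < theta -> 0 < a < b -> excess theta h a * excess theta h b < 0 ->
  exists s, a < s < b /\ ferro theta h (s / theta) 0 /\ ferro theta h (s / theta) PI.
Proof.
intros Ht Hab Hsgn.
destruct (IVT_cor (excess theta h) a b) as [s [Hs Es]]; [|lra|lra|].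
{ intros x. apply continuity_pt_filterlim, (@ex_derive_continuous R_AbsRing R_NormedModule).
  eexists. apply excess_derive. }
assert (HPI := PI_RGT_0).
assert (Has : s <> a) by (intros E; rewrite E in Es; rewrite Es in Hsgn; lra).
assert (Hbs : s <> b) by (intros E; rewrite E in Es; rewrite Es in Hsgn; lra).
assert (E : 2 * (s / theta) =
  A (2 * (h + theta * (s / theta))) - A (2 * (h - theta * (s / theta)))).
{ replace (theta * (s / theta)) with s by (field; lra).
  change (2 * (s / theta) = odd_part h s). unfold excess in Es.
  replace (2 * (s / theta)) with (2 / theta * s) by (field; lra). lra. }
assert (Hr : 0 < s / theta) by (apply Rdiv_lt_0_compat; lra).
exists s. split; [lra|].
split; apply ferro_axis_iff; auto using sin_0, sin_PI; lra.
Qed.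

Lemma exists_axis (theta h : R) :
  0 < h -> 0 < theta -> theta2 h < theta ->
  exists r, ferro theta h r 0 /\ ferro theta h r PI.
Proof.
intros Hh Ht Hlt. apply theta2_lt_iff in Hlt; trivial.
destruct (positive_right_of_0 (excess theta h) _ (2 * theta) (excess_derive_0 theta h))
  as [s [Hs Hpos]].
- apply excess_0.
- replace (4 * dA (2 * h) - 2 / theta) with (2 / theta * (2 * theta * dA (2 * h) - 1))
    by (field; lra).
  apply Rmult_lt_0_compat; [|lra]. apply Rdiv_lt_0_compat; lra.
- lra.
- destruct (axis_root theta h s (2 * theta)) as [x [_ Hx]]; trivial.
  + generalize (excess_far theta h Ht). nra.
  + now exists (x / theta).
Qed.

(** The signs of [excess] are negative just right of [0] because [theta < theta2 h], positive at
    [s0], negative at [2 * theta]; the two roots are separated by [s0]. *)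
Lemma exists_two_axis (theta h s0 : R) :
  0 < h -> 0 < theta -> theta < theta2 h -> 0 < s0 -> 0 < excess theta h s0 ->
  exists rb rh, rb <> rh /\
    ferro theta h rb 0 /\ ferro theta h rb PI /\
    ferro theta h rh 0 /\ ferro theta h rh PI.
Proof.
intros Hh Ht Hlt Hs0 Hpos.
assert (Hlt' : 2 * theta * dA (2 * h) < 1).
{ assert (HA : 0 < dA (2 * h)) by (apply dA_pos; lra).
  rewrite theta2_eq in Hlt.
  assert (E : 1 - 2 * theta * dA (2 * h) = 2 * dA (2 * h) * (/ 2 * / dA (2 * h) - theta))
    by (field; lra).
  nra. }
destruct (positive_right_of_0 (fun s => - excess theta h s) _ s0
  (is_derive_opp (V := R_NormedModule) _ _ _ (excess_derive_0 theta h))) as [s [Hs Hneg]].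
- rewrite excess_0. ring.
- change (0 < - (4 * dA (2 * h) - 2 / theta)).
  replace (- (4 * dA (2 * h) - 2 / theta)) with (2 / theta * (1 - 2 * theta * dA (2 * h)))
    by (field; lra).
  apply Rmult_lt_0_compat; [|lra]. apply Rdiv_lt_0_compat; lra.
- lra.
- assert (Hfar : s0 < 2 * theta).
  { unfold excess, odd_part in Hpos.
    generalize (A_bound (2 * (h + s0))) (A_bound (2 * (h - s0))). intros H1 H2.
    assert (H : 2 / theta * s0 < 2) by lra.
    replace s0 with (2 / theta * s0 * theta / 2) by (field; lra). nra. }
  destruct (axis_root theta h s s0) as [x [Hx [Hx0 Hx1]]]; trivial; [nra|].
  destruct (axis_root theta h s0 (2 * theta)) as [y [Hy [Hy0 Hy1]]]; trivial; [lra| |].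
  { generalize (excess_far theta h Ht). nra. }
  exists (x / theta), (y / theta). split; [|now auto].
  intros E. apply Rmult_eq_reg_r in E; [lra|]. apply Rinv_neq_0_compat. lra.
Qed.

Theorem theorem2 (h hbar : R) (hh : 0 < h)
  (Hhbar : forall theta h', 0 < theta -> 0 < h' -> (D3 theta h' = 0 <-> h' = hbar)) :
  (* (i) *)
  (forall theta, 0 < theta -> theta <= theta1 h ->
     forall r Psi, ~ ferro theta h r Psi) /\
  (* (ii) *)
  (h <= hbar -> forall theta, 0 < theta -> theta1 h < theta <= theta2 h ->
     exists r, ferro theta h r (PI / 2) /\ ferro theta h r (3 * PI / 2)) /\
  (* (iii) *)
  (hbar < h ->
     exists theta_s, theta1 h < theta_s < theta2 h /\
       (forall theta, 0 < theta -> theta1 h < theta <= theta_s ->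
          exists r, ferro theta h r (PI / 2) /\ ferro theta h r (3 * PI / 2)) /\
       (forall theta, 0 < theta -> theta_s < theta < theta2 h ->
          (exists r, ferro theta h r (PI / 2) /\ ferro theta h r (3 * PI / 2)) /\
          (exists rb rh, rb <> rh /\
             ferro theta h rb 0 /\ ferro theta h rb PI /\
             ferro theta h rh 0 /\ ferro theta h rh PI))) /\
  (* (iv) *)
  (forall theta, 0 < theta -> theta2 h < theta ->
     (exists r, ferro theta h r (PI / 2) /\ ferro theta h r (3 * PI / 2)) /\
     (exists rb, ferro theta h rb 0 /\ ferro theta h rb PI)).
Proof.
assert (H12 := theta1_lt_theta2 h hh).
split; [|split; [|split]].
- intros theta Ht Hle r Psi. now apply no_ferro.
- intros _ theta Ht Hlt. apply exists_transverse; lra.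
- intros Hh.
  (* A zero [y >= 2 h] of [d3A] would make [y / 2] a zero of [D3 1], hence equal to [hbar < h]. *)
  assert (H3 : 0 < d3A (2 * h)).
  { apply d3A_pos_beyond; [lra|]. intros y Hy E.
    assert (Hy2 : y / 2 = hbar); [|lra].
    apply (Hhbar 1); [lra | lra |]. rewrite D3_eq.
    replace (2 * (y / 2)) with y by field. rewrite E. ring. }
  destruct (odd_part_above_tangent h H3) as [s0 [Hs0 Hs]].
  assert (HA : 0 < dA (2 * h)) by (apply dA_pos; lra).
  assert (HG : 0 < odd_part h s0) by nra.
  (* The coupling for which [s0] is exactly a root of [excess]. *)
  set (t := 2 * s0 / odd_part h s0).
  (* Equivalent to [s0] lying strictly above the tangent, as [theta2 h = 1 / (2 dA (2 h))]. *)
  assert (Ht2 : t < theta2 h).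
  { rewrite theta2_eq. unfold t.
    apply Rmult_lt_reg_r with (2 * dA (2 * h) * odd_part h s0); [nra|].
    field_simplify; nra. }
  (* The midpoint guarantees a value above [theta1 h]; beyond [t] the excess at [s0] is positive. No
     sharpness of this threshold is claimed. *)
  exists (Rmax t ((theta1 h + theta2 h) / 2)).
  assert (Hm1 := Rmax_l t ((theta1 h + theta2 h) / 2)).
  assert (Hm2 := Rmax_r t ((theta1 h + theta2 h) / 2)).
  split; [|split].
  + split; [lra|]. apply Rmax_lub_lt; lra.
  + intros theta Ht Hlt. apply exists_transverse; lra.
  + intros theta Ht Hlt. split; [apply exists_transverse; lra|].
    apply (exists_two_axis theta h s0); trivial; [lra|].
    assert (Hst : 2 * s0 < theta * odd_part h s0).
    { replace (2 * s0) with (t * odd_part h s0) by (unfold t; field; lra).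
      apply Rmult_lt_compat_r; lra. }
    unfold excess.
    replace (odd_part h s0 - 2 / theta * s0) with ((theta * odd_part h s0 - 2 * s0) / theta)
      by (field; lra).
    apply Rdiv_lt_0_compat; lra.
- intros theta Ht Hlt. split.
  + apply exists_transverse; lra.
  + now apply exists_axis.
Qed.
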